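(* Let $\Gamma=(G,\sigma)$ be a signed graph with $G=(V,E)$, $|V|=n$. Let $1\le m\le n-1$ and let $\Gamma'=(G',\sigma)$, where $G'=(V',E')$ is the induced subgraph of $G$ obtained by removing $m$ vertices from $V$ (with $\sigma,w,\mu,\kappa$ restricted). Then for every $1\le k\le n-m$, $$L_k(\Gamma)\le L_k(\Gamma')\le L_{k+m}(\Gamma).$$
   Context: $G=(V,E)$ is a finite undirected graph without self-loops, $V=\{1,\dots,n\}$. A signed graph $\Gamma=(G,\sigma)$ has signature $\sigma:E\to\{\pm1\}$, $\sigma_{ij}=\sigma(\{i,j\})$, edge weight $w:E\to(0,\infty)$, vertex measure $\mu:V\to(0,\infty)$, potential $\kappa:V\to\mathbb R$. For $p\ge1$ and nonzero $f$, $\mathcal R_p^\sigma(f)=\frac{\sum_{\{i,j\}\in E}w_{ij}|f(i)-\sigma_{ij}f(j)|^p+\sum_i\kappa_i|f(i)|^p}{\sum_i\mu_i|f(i)|^p}$; $\mathcal S_p=\{f:\sum_i\mu_i|f(i)|^p=1\}$. The Krasnoselskii genus $\gamma(B)$ of a closed symmetric $B\subset\mathbb R^n\setminus\{0\}$ is the least $k$ with an odd continuous map $B\to\mathbb R^k\setminus\{0\}$; $\mathcal F_k(\mathcal S_p)$ = closed symmetric $B\subset\mathcal S_p$ with $\gamma(B)\ge k$. Variational eigenvalues: $\lambda_k^{(p)}(\Gamma)=\min_{B\in\mathcal F_k(\mathcal S_p)}\max_{f\in B}\mathcal R_p^\sigma(f)$. Cut-off adjacency eigenvalues: $L_k(\Gamma):=\lim_{p\to\infty}2^{-p}\lambda_k^{(p)}(\Gamma)$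 (the limits exist and are independent of $\kappa$); for a graph on $N$ vertices these are defined for $k=1,\dots,N$. *)

(* Defs.v *)
From HB Require Import structures.
From mathcomp Require Import all_boot all_order all_algebra.
From mathcomp Require Import all_classical all_reals all_analysis.
Set Implicit Arguments. Unset Strict Implicit. Unset Printing Implicit Defensive.
Import Order.TTheory GRing.Theory Num.Theory.
Import numFieldNormedType.Exports.
Local Open Scope classical_set_scope.
Local Open Scope ring_scope.

Record sgraph (R : realType) (n : nat) := SGraph {
  adj : rel 'I_n;
  sgn : 'I_n -> 'I_n -> R;        (* signature sigma_ij, used on edges *)
  wt  : 'I_n -> 'I_n -> R;        (* edge weight w_ij, used on edges *)
  mu  : 'I_n -> R;
  kap : 'I_n -> R
}.

Section Defs.
Variable R : realType.

Definition sgraph_wf n (G : sgraph R n) : Prop :=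
  [/\ forall i j, adj G i j = adj G j i,
      forall i, ~~ adj G i i,
      forall i j, adj G i j ->
        (sgn G i j = 1 \/ sgn G i j = -1) /\ sgn G i j = sgn G j i,
      forall i j, adj G i j -> 0 < wt G i j /\ wt G i j = wt G j i
    & forall i, 0 < mu G i].

(* induced subgraph on the vertices h('I_n'), h injective *)
Definition sg_induced n n' (G : sgraph R n) (h : 'I_n' -> 'I_n) : sgraph R n' :=
  SGraph (fun i j => adj G (h i) (h j)) (fun i j => sgn G (h i) (h j))
         (fun i j => wt G (h i) (h j)) (fun i => mu G (h i))
         (fun i => kap G (h i)).

Definition rq_num n (G : sgraph R n) (p : R) (f : 'rV[R]_n) : R :=
  \sum_(i < n) \sum_(j < n | ((i < j)%N && adj G i j))
      wt G i j * powR `|f 0 i - sgn G i j * f 0 j| p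
  + \sum_(i < n) kap G i * powR `|f 0 i| p.

Definition rq_den n (G : sgraph R n) (p : R) (f : 'rV[R]_n) : R :=
  \sum_(i < n) mu G i * powR `|f 0 i| p.

Definition rayleigh n (G : sgraph R n) (p : R) (f : 'rV[R]_n) : R :=
  rq_num G p f / rq_den G p f.

Definition Sp n (G : sgraph R n) (p : R) : set 'rV[R]_n :=
  [set f | rq_den G p f = 1].

Definition symmetric_set n (B : set 'rV[R]_n) : Prop :=
  forall x, B x -> B (- x).

(* Krasnoselskii genus gamma(B) >= k: there is no odd continuous map
   B -> R^j \ {0} for any j < k  (gamma(B) = +oo allowed). *)
Definition genus_ge n (B : set 'rV[R]_n) (k : nat) : Prop :=
  forall j : nat, (j < k)%N ->
    ~ exists g : 'rV[R]_n -> 'rV[R]_j,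
        {within B, continuous g} /\
        (forall x, B x -> g (- x) = - g x /\ g x != 0).

Definition Fk n (G : sgraph R n) (p : R) (k : nat) : set (set 'rV[R]_n) :=
  [set B | B `<=` Sp G p /\ closed B /\ symmetric_set B /\ genus_ge B k].

Definition lambda n (G : sgraph R n) (p : R) (k : nat) : R :=
  inf [set sup [set rayleigh G p f | f in B] | B in Fk G p k].

Definition Lcut n (G : sgraph R n) (k : nat) : R :=
  lim ((fun p : R => powR 2 (- p) * lambda G p k) @ +oo).

End Defs.

(* Main.v *)
Require Import Defs.
From HB Require Import structures.
From mathcomp Require Import all_boot all_order all_algebra.
From mathcomp Require Import all_classical all_reals all_analysis.
From mathcomp Require Import lra.
Import Order.TTheory GRing.Theory Num.Theory.
Import numFieldNormedType.Exports.
Set Implicit Arguments. Unset Strict Implicit. Unset Printing Implicit Defensive.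
Local Open Scope classical_set_scope.
Local Open Scope ring_scope.

(** Up to the bounded term [kap_bound], [2^-p lambda_k^(p)] decreases in p: the
    substitution [f |-> sgn f |f|^(q/p)] maps S_q onto S_p, preserves the genus,
    and contracts the edge terms since [(|x - y|/2)^r <= |x^r - y^r|/2] for signed
    powers with r >= 1. Hence the limits exist.

    Extension by zero sends F_k(S_p(Gamma')) into F_k(S_p(Gamma)) and changes the
    Rayleigh quotient by a nonnegative term bounded independently of p, which
    [2^-p] kills; this gives the first inequality. Conversely, slicing a set of
    genus >= k + m by the m coordinate hyperplanes of the removed vertices leaves
    genus >= k, by Tietze's theorem; this gives the second.

    Since [inf set0 = 0], one also needs F_k(S_p) to be nonempty for k <= n, i.e.
    the Borsuk-Ulam theorem. It is proved with mod 2 cochains: with s_i the sign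
    of the i-th coordinate of an odd map, made odd also at its zeros, the cochain
    [alpha = s_k u ds_(k-1) u ... u ds_0] satisfies
    [alpha + antipode^* alpha = d(s_(k-1) u ... u ds_0)], so its pairing with the
    cross-polytope sphere is 1 in every degree k < n, also after subdivision. If
    the map goes to R^j without zeros, j < n, then on a fine subdivision every
    simplex has some s_i constant, so alpha vanishes in degree n - 1. *)

(** * Mod 2 cochains and barycentric subdivision *)

Section Cochains.
Variable V : eqType.
Implicit Types (phi psi : seq V -> bool) (s t : seq V).

(** Mod 2 coboundary: the sum of [phi] over the sequences obtained by deleting one entry, either the
    head or, with the head kept, a later one. *)
Fixpoint cobd phi s : bool :=
  if s is v :: s' then phi s' (+) cobd (fun t => phi (v :: t)) s' else false.

Lemma eq_cobd phi psi s :
  (forall t, {subset t <= s} -> size s = (size t).+1 -> phi t = psi t) ->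
  cobd phi s = cobd psi s.
Proof.
elim: s phi psi => //= v s IH phi psi H; congr addb.
  by apply: H => // w; rewrite inE orbC => ->.
apply: IH => t ts st; apply: H => /=; last by rewrite st.
by move=> w; rewrite !inE => /orP[->//|/ts ->]; rewrite orbT.
Qed.

Lemma cobdD phi psi s :
  cobd (fun t => phi t (+) psi t) s = cobd phi s (+) cobd psi s.
Proof.
elim: s phi psi => //= v s IH phi psi; rewrite IH.
by rewrite addbACA.
Qed.

Lemma cobd_andb c phi s : cobd (fun t => c && phi t) s = c && cobd phi s.
Proof.
elim: s phi => [|v s IH] phi /=; first by rewrite andbF.
by rewrite IH; case: c {IH}.
Qed.

Lemma cobd_cobd phi s : cobd (cobd phi) s = false.
Proof.
elim: s phi => //= v s IH phi.
by rewrite cobdD IH addbF addbb.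
Qed.

End Cochains.

Lemma cobd_map (V W : eqType) (f : V -> W) (phi : seq W -> bool) s :
  cobd (fun t => phi (map f t)) s = cobd phi (map f s).
Proof.
by elim: s phi => //= v s IH phi; rewrite (IH (fun t => phi (f v :: t))).
Qed.

(** * Barycentric subdivision, mesh estimates and the cross-polytope cycle *)

Section Subdivision.
Variables (R : realType) (V : normedModType R).
Implicit Types (phi psi : seq V -> bool) (s t : seq V).

Definition bary s : V := (size s)%:R^-1 *: \sum_(v <- s) v.

Lemma bary_opp s : bary (map -%R s) = - bary s.
Proof. by rewrite /bary size_map big_map sumrN scalerN. Qed.

(** The recursion passes to faces of [s], which are not subterms, so [k] counts the levels; it is
    meant to be [size s]. *)
Fixpoint sdn k phi s : bool :=
  if k is k'.+1 then cobd (sdn k' (fun t => phi (bary s :: t))) s else phi s.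

(* The cochain dual to barycentric subdivision: the subdivision of a simplex is
   the cone from its barycenter over the subdivision of its boundary. *)
Definition sd phi s := sdn (size s) phi s.

Lemma sd_cons phi v s : sd phi (v :: s) =
  cobd (sd (fun t => phi (bary (v :: s) :: t))) (v :: s).
Proof.
rewrite /sd /sdn -/sdn [size (v :: s)]/=.
by apply: eq_cobd => t _ [->].
Qed.

Lemma sdn_add k phi psi s :
  sdn k (fun t => phi t (+) psi t) s = sdn k phi s (+) sdn k psi s.
Proof.
elim: k phi psi s => //= k IH phi psi s; rewrite -cobdD.
by apply: eq_cobd => t _ _; rewrite IH.
Qed.

Lemma sd_add phi psi :
  sd (fun t => phi t (+) psi t) = fun t => sd phi t (+) sd psi t.
Proof. by apply/funext => s; exact: sdn_add. Qed.

Lemma sd0 : sd (fun=> false) = fun=> false.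
Proof. by rewrite -[RHS](funext (fun s => addbb (sd xpred0 s))) -sd_add. Qed.

Lemma sd_opp phi : sd (fun t => phi (map -%R t)) = fun t => sd phi (map -%R t).
Proof.
apply/funext => s; rewrite /sd size_map.
move: (size s) => k; elim: k phi s => //= k IH phi s.
rewrite -cobd_map; apply: eq_cobd => t _ _.
by rewrite -IH bary_opp.
Qed.

(** Splitting [cobd phi] at the cone point [bary (v :: s)] gives [phi] plus a coboundary on the
    faces; by induction the latter subdivides to a coboundary, which the outer [cobd] kills. *)
Lemma sd_cobd phi : sd (cobd phi) = cobd (sd phi).
Proof.
apply/funext => s; have [k] := ubnP (size s).
elim: k phi s => // k IH phi [//|v s] sk.
rewrite sd_cons (_ : sd _ =
  fun t => sd phi t (+) sd (cobd (fun u => phi (bary (v :: s) :: u))) t).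
  rewrite cobdD -[RHS]addbF; congr addb.
  rewrite -[RHS](cobd_cobd (sd (fun u => phi (bary (v :: s) :: u))) (v :: s)).
  by apply: eq_cobd => t _ [st]; rewrite IH// -st.
by rewrite -sd_add.
Qed.

(** Convexity, in the form that subdivision uses. *)
Definition closed_bary (D : V -> Prop) :=
  forall s, s != [::] -> (forall v, v \in s -> D v) -> D (bary s).

Lemma bary_ball (c : V) r : closed_bary (fun v => `|c - v| <= r).
Proof.
move=> [//|v s] _ H /=; set u := v :: s.
have u0 : (0 : R) < (size u)%:R by rewrite ltr0n.
have -> : c - bary u = (size u)%:R^-1 *: \sum_(w <- u) (c - w).
  rewrite big_split/= sumrN scalerDr scalerN big_const_seq count_predT.
  by rewrite iter_addr_0 -[c *+ _]scaler_nat scalerA mulVf ?gt_eqF// scale1r.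
rewrite normrZ normfV normr_nat ler_pdivrMl//.
apply: le_trans (ler_norm_sum _ _ _) _.
apply: le_trans (_ : \sum_(w <- u) r <= _).
  by rewrite big_seq [leRHS]big_seq; apply: ler_sum => w; exact: H.
by rewrite big_const_seq count_predT iter_addr_0 mulr_natl.
Qed.

(** In the average of the [w - v] over [s], the term of [v] itself vanishes, whence the factor below
    1. *)
Lemma bary_dist s v r : v \in s -> (forall w, w \in s -> `|w - v| <= r) ->
  `|bary s - v| <= (1 - (size s)%:R^-1) * r.
Proof.
move=> vs H.
have s0 : (0 : R) < (size s)%:R by rewrite ltr0n; case: s vs {H}.
have -> : bary s - v = (size s)%:R^-1 *: \sum_(w <- s) (w - v).
  rewrite big_split/= sumrN scalerDr scalerN big_const_seq count_predT.
  by rewrite iter_addr_0 -[v *+ _]scaler_nat scalerA mulVf ?gt_eqF// scale1r.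
rewrite normrZ normfV normr_nat ler_pdivrMl//.
rewrite mulrA mulrBr mulr1 divff ?gt_eqF//.
apply: le_trans (ler_norm_sum _ _ _) _.
rewrite (big_rem v)//= subrr normr0 add0r.
apply: le_trans (_ : \sum_(w <- rem v s) r <= _).
  by rewrite big_seq [leRHS]big_seq; apply: ler_sum => w /mem_rem; exact: H.
rewrite big_const_seq count_predT iter_addr_0 size_rem// -[leLHS]mulr_natl.
by rewrite -subn1 natrB//; case: s vs {s0 H}.
Qed.

Definition mesh_le s r := forall v w, v \in s -> w \in s -> `|v - w| <= r.

(** [sd phi s] reads [phi] only on simplices of the subdivision of [s]: their vertices stay in [D]
    and the mesh shrinks by [1 - 1/(N+1)], where [N] bounds the dimension of [s]. *)
Lemma eq_sd N (D : V -> Prop) r phi psi s : closed_bary D -> 0 <= r ->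
  (size s <= N.+1)%N -> (forall v, v \in s -> D v) -> mesh_le s r ->
  (forall t, size t = size s -> (forall v, v \in t -> D v) ->
     mesh_le t ((1 - N.+1%:R^-1) * r) -> phi t = psi t) ->
  sd phi s = sd psi s.
Proof.
move=> + r0; have [k] := ubnP (size s).
elim: k D phi psi s => // k IH D phi psi [|v s] sk cD sN Ds ms H; first exact: H.
rewrite !sd_cons; set u := v :: s in sk sN Ds ms H *.
apply: eq_cobd => t tu [/esym st].
pose b := bary u; pose r' := (1 - N.+1%:R^-1) * r.
have bu w : w \in u -> `|b - w| <= r'.
  move=> wu; apply: le_trans (bary_dist wu (fun w' w'u => ms _ _ w'u wu)) _.
  by rewrite ler_wpM2r// lerB// lef_pV2 ?posrE ?ltr0n// ler_nat.
(* The smaller domain also records the distance to [b], which bounds the mesh once [b] is put in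
   front. *)
apply: (IH (fun w => D w /\ `|b - w| <= r')).
- by rewrite st.
- move=> q q0 Hq; split; first by apply: cD => // w /Hq[].
  by apply: bary_ball => // w /Hq[].
- by rewrite st ltnW.
- by move=> w wt; split; [exact/Ds/tu|exact/bu/tu].
- by move=> x y xt yt; apply: ms; exact: tu.
move=> q qt Dq mq; apply: H => /=; first by rewrite qt st.
  move=> w; rewrite inE => /predU1P[->|/Dq[]//].
  exact: cD.
move=> x y; rewrite !inE => /predU1P[->|xq] /predU1P[->|yq].
- by rewrite subrr normr0 mulr_ge0// subr_ge0 invf_le1 ?ltr0n// ler1n.
- by have [] := Dq _ yq.
- by rewrite distrC; have [] := Dq _ xq.
- exact: mq.
Qed.

Lemma eq_iter_sd M N (D : V -> Prop) r phi psi s : closed_bary D -> 0 <= r ->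
  (size s <= N.+1)%N -> (forall v, v \in s -> D v) -> mesh_le s r ->
  (forall t, size t = size s -> (forall v, v \in t -> D v) ->
     mesh_le t ((1 - N.+1%:R^-1) ^+ M * r) -> phi t = psi t) ->
  iter M sd phi s = iter M sd psi s.
Proof.
move=> cD; elim: M s r => [|M IH] s r r0 sN Ds ms H.
  by apply: H => // v w vs ws; rewrite expr0 mul1r; exact: ms.
rewrite !iterS; apply: (eq_sd cD r0 sN Ds ms) => t ts Dt mt.
have c0 : (0 : R) <= 1 - N.+1%:R^-1 by rewrite subr_ge0 invf_le1 ?ltr0n// ler1n.
apply: (IH _ ((1 - N.+1%:R^-1) * r)) => //; rewrite ?ts//.
  exact: mulr_ge0.
by move=> q qt Dq mq; apply: H; rewrite ?qt// exprSr -mulrA.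
Qed.

Variable e : nat -> V.

(* The mod 2 fundamental chain of the boundary of the k-dimensional
   cross-polytope, seen as a functional on cochains. *)
Fixpoint cross k phi : bool :=
  if k is k'.+1 then cross k' (fun t => phi (e k' :: t)) (+)
                     cross k' (fun t => phi (- e k' :: t))
  else phi [::].

(** A facet of the cross-polytope, with its signs given by [b] and its axes listed from the highest
    down, as in [cross]. *)
Definition face (b : nat -> bool) k :=
  [seq (-1) ^+ b i *: e i | i <- rev (iota 0 k)].

Lemma faceS b k : face b k.+1 = (-1) ^+ b k *: e k :: face b k.
Proof. by rewrite /face -addn1 iotaD add0n rev_cat. Qed.

Lemma eq_cross k phi psi :
  (forall b, phi (face b k) = psi (face b k)) -> cross k phi = cross k psi.
Proof.
elim: k phi psi => [|k IH] phi psi H; first exact: (H xpredT).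
have E c b : face (fun i => if i == k then c else b i) k = face b k.
  apply/eq_in_map => i; rewrite mem_rev mem_iota add0n => /andP[_ ik].
  by rewrite lt_eqF.
rewrite /=; congr addb; apply: IH => b.
  have := H (fun i => if i == k then false else b i).
  by rewrite faceS eqxx scale1r E.
have := H (fun i => if i == k then true else b i).
by rewrite faceS eqxx expr1 scaleN1r E.
Qed.

Lemma cross0 k : cross k (fun=> false) = false.
Proof. by elim: k => //= k ->. Qed.

Lemma cross_add k phi psi :
  cross k (fun t => phi t (+) psi t) = cross k phi (+) cross k psi.
Proof. by elim: k phi psi => //= k IH phi psi; rewrite !IH addbACA. Qed.

Lemma cross_opp k phi : cross k (fun t => phi (map -%R t)) = cross k phi.
Proof.
elim: k phi => //= k IH phi.
by rewrite (IH (fun t => phi (- e k :: t))) (IH (fun t => phi (- - e k :: t)))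
  opprK addbC.
Qed.

(** The cross-polytope sphere is a cycle: deleting a leading [e k] or [- e k] leaves the same faces,
    so these terms cancel; the rest vanish by induction. *)
Lemma cross_cobd k phi : cross k (cobd phi) = false.
Proof.
elim: k phi => //= k IH phi.
by rewrite !cross_add !IH !addbF addbb.
Qed.

(** The antipode folds the sphere onto the hemisphere with apex [e k], where the folded cochain is
    [cobd psi]. That hemisphere is bounded by the sphere one dimension lower, so Stokes leaves the
    value on [psi]. *)
Lemma cross_step k phi psi :
  (forall b, phi (face b k.+1) (+) phi (map -%R (face b k.+1)) =
             cobd psi (face b k.+1)) ->
  cross k.+1 phi = cross k psi.
Proof.
move=> H /=; rewrite -[X in _ (+) X]cross_opp -cross_add.
rewrite -[RHS]addbF -[X in _ (+) X](cross_cobd k (fun t => psi (e k :: t))).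
rewrite -cross_add; apply: eq_cross => b.
have := H (fun i => if i == k then false else b i).
rewrite faceS eqxx scale1r.
suff -> : face (fun i => if i == k then false else b i) k = face b k by [].
apply/eq_in_map => i; rewrite mem_rev mem_iota add0n => /andP[_ ik].
by rewrite lt_eqF.
Qed.

End Subdivision.

Lemma addb_eq (a b : bool) : a (+) b = false -> a = b.
Proof. by case: a; case: b. Qed.

(** * Cup products of sign coboundaries *)

Section SignCochain.
Variables (R : realType) (V : normedModType R) (sg : nat -> V -> bool).
Implicit Types s t : seq V.

(** The cup product d sg_(k-1) u ... u d sg_0 in degree k. Indices are read off the length of the
    tail, so a tail carries the product of lower degree. *)
Fixpoint sign_cycle s : bool :=
  if s is v :: s' then
    if s' is w :: t then (sg (size t) v (+) sg (size t) w) && sign_cycle s'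
    else true
  else true.

(* The cup product sg_k u (d sg_(k-1)) u ... u (d sg_0) in degree k. *)
Definition sign_cochain s : bool :=
  if s is v :: s' then sg (size s') v && sign_cycle s else true.

Lemma sign_cycle_cons v w t : sign_cycle [:: v, w & t] =
  (sg (size t) v (+) sg (size t) w) && sign_cycle (w :: t).
Proof. by []. Qed.

(** A product of coboundaries is a cocycle. Two vertices are required: on one vertex the value
    [true] on the empty sequence remains. *)
Lemma cobd_sign_cycle v w s : cobd sign_cycle (v :: w :: s) = false.
Proof.
elim: s v w => [//|x s IH] v w.
have E y : cobd (fun t => sign_cycle (y :: t)) (x :: s) = sign_cycle (x :: s).
  exact/esym/addb_eq/(IH y x).
have -> : cobd sign_cycle [:: v, w, x & s] = sign_cycle [:: w, x & s] (+)
  (sign_cycle [:: v, x & s] (+)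
   cobd (fun t => sign_cycle [:: v, w & t]) (x :: s)) by [].
rewrite (@eq_cobd _ _ (fun t => (sg (size s) v (+) sg (size s) w) &&
   sign_cycle (w :: t))); last by move=> t _ [->].
rewrite cobd_andb E !sign_cycle_cons.
by case: (sg _ v); case: (sg _ w); case: (sg _ x); case: sign_cycle.
Qed.

Lemma sign_cochain_cons v s :
  sign_cochain (v :: s) = sg (size s) v && sign_cycle (v :: s).
Proof. by []. Qed.

Lemma sign_cycle_opp s : (forall i v, v \in s -> sg i (- v) = ~~ sg i v) ->
  sign_cycle (map -%R s) = sign_cycle s.
Proof.
elim: s => // v [//|w s] IH H /=; rewrite size_map.
have -> := H _ v; last by rewrite mem_head.
have -> := H _ w; last by rewrite !inE eqxx orbT.
congr andb; first by case: sg; case: sg.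
by apply: IH => i u us; apply: H; rewrite inE us orbT.
Qed.

(** For nonempty [s] both sides are [sign_cycle s]. The antipode preserves [sign_cycle] and flips
    the leading sign; on the right, [cobd] turns the leading sign into its coboundary, the other
    factors being cocycles. *)
Lemma cobd_sign_cochain s : (forall i v, v \in s -> sg i (- v) = ~~ sg i v) ->
  sign_cochain s (+) sign_cochain (map -%R s) = cobd sign_cochain s.
Proof.
case: s => // v s H.
rewrite [map _ _]/= !sign_cochain_cons size_map H ?mem_head//.
rewrite -[_ :: map _ s]/(map -%R (v :: s)) sign_cycle_opp//.
transitivity (sign_cycle (v :: s)); first by case: sg => //=; rewrite addbF.
case: s {H} => // w s.
have E : sign_cycle (w :: s) = cobd (fun t => sign_cycle (v :: t)) (w :: s).
  exact/addb_eq/(cobd_sign_cycle v w s).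
have -> : cobd sign_cochain [:: v, w & s] = sign_cochain (w :: s) (+)
  cobd (fun t => sign_cochain (v :: t)) (w :: s) by [].
have -> : cobd (fun t => sign_cochain (v :: t)) (w :: s) =
    sg (size s) v && cobd (fun t => sign_cycle (v :: t)) (w :: s).
  by rewrite -cobd_andb; apply: eq_cobd => t _ [->].
rewrite -E sign_cochain_cons sign_cycle_cons.
by case: (sg _ v); case: (sg _ w); case: sign_cycle.
Qed.

(** A sign constant on the simplex has zero coboundary there; [i.+1 < size s] puts [i] among the
    coboundary factors. *)
Lemma sign_cochain_eq0 i b s : (i.+1 < size s)%N ->
  (forall v, v \in s -> sg i v = b) -> sign_cochain s = false.
Proof.
move=> si H; suff : sign_cycle s = false.
  by case: s si H => // v s _ _ /= ->; rewrite andbF.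
elim: s si H => // v [//|w s] IH; rewrite [size _]/= !ltnS leq_eqVlt.
rewrite sign_cycle_cons => /predU1P[<-|si] H.
  by rewrite !H ?addbb// !inE eqxx ?orbT.
by rewrite IH ?andbF// => u us; apply: H; rewrite inE us orbT.
Qed.

End SignCochain.

(** * The Borsuk-Ulam theorem *)

Lemma cvg_row (R : realType) (T : Type) (F : set_system T) (FF : Filter F) n
    (f : T -> 'rV[R]_n) (v : 'rV[R]_n) :
  (forall i, (f x 0 i) @[x --> F] --> v 0 i) -> f @ F --> v.
Proof.
move=> H A [P HP sPA].
have FP : F [set x | forall i, P 0 i (f x 0 i)].
  apply: (@filter_forall _ _ (fun i => [set x | P 0 i (f x 0 i)]) _ FF) => i.
  exact: (H i _ (HP 0 i)).
apply: (@filterS _ F FF _ (f @^-1` A) _ FP) => x Px.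
by apply: sPA => i j; rewrite (ord1 i).
Qed.

Lemma within_comp (T U W : topologicalType) (A : set T) (B : set U)
    (f : T -> U) (g : U -> W) :
  {within A, continuous f} -> (forall x, A x -> B (f x)) ->
  {within B, continuous g} -> {within A, continuous (g \o f)}.
Proof.
move=> /subspace_continuousP cf AB /subspace_continuousP cg.
apply/subspace_continuousP => x Ax X /(cg _ (AB _ Ax)) /= /(cf _ Ax) /=.
by rewrite /nbhs/= /within/=; apply: filterS => y H Ay; exact/H/AB.
Qed.

(** * The l1 sphere as the boundary of the cross-polytope *)

Section LOneSphere.
Variables (R : realType) (n : nat).
Implicit Types v : 'rV[R]_n.

Definition l1norm (v : 'rV[R]_n) := \sum_j `|v 0 j|.
Definition l1sphere : set 'rV[R]_n := [set v | l1norm v = 1].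

Lemma l1sphere_neq0 v : l1sphere v -> v != 0.
Proof.
move=> v1; apply/eqP => v0; move: v1; rewrite v0 /l1sphere/= /l1norm.
under eq_bigr do rewrite mxE normr0.
by rewrite big1_eq => /esym/eqP; rewrite oner_eq0.
Qed.

Lemma continuous_l1norm : continuous l1norm.
Proof.
apply: continuous_big; first exact: add_continuous.
move=> i _ v; apply: continuous_comp; last exact: norm_continuous.
exact: coord_continuous.
Qed.

Lemma coord_le_l1norm v i : `|v 0 i| <= l1norm v.
Proof. by rewrite /l1norm (bigD1 i)//= lerDl sumr_ge0. Qed.

Lemma norm_le_l1norm v : `|v| <= l1norm v.
Proof.
rewrite -[`|v|]/(mx_norm v) mx_normrE; apply/bigmax_leP; split.
  exact: sumr_ge0.
by move=> [i j] _ /=; rewrite (ord1 i) coord_le_l1norm.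
Qed.

Lemma compact_l1sphere : compact l1sphere.
Proof.
apply: bounded_closed_compact.
  exists 1; split; first exact: num_real.
  move=> M M1 v v1; apply: le_trans (norm_le_l1norm _) _.
  by rewrite [l1norm v]v1 ltW.
apply: (@preimage_closed _ _ l1norm [set 1]); last exact: closed_eq.
by move=> v _; exact: continuous_l1norm.
Qed.

(** The closed facet of the l1 sphere in the orthant of [b]. Its conditions are linear, so
    subdividing a facet never leaves the sphere. *)
Definition cross_face (b : 'I_n -> bool) (v : 'rV[R]_n) :=
  (forall j, 0 <= (-1) ^+ b j * v 0 j) /\ \sum_j (-1) ^+ b j * v 0 j = 1.

Lemma cross_face_l1 b v : cross_face b v -> l1sphere v.
Proof.
move=> [v0 v1]; rewrite /l1sphere/= -v1; apply: eq_bigr => j _.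
rewrite -[RHS]ger0_norm// normrM normrX normrN1 expr1n mul1r //.
Qed.

Lemma closed_bary_cross_face b : closed_bary (cross_face b).
Proof.
move=> [//|v s] _ H; set u := v :: s.
have bE j : bary u 0 j = (size u)%:R^-1 * \sum_(w <- u) w 0 j.
  by rewrite mxE summxE.
split.
  move=> j; rewrite bE mulrCA mulr_ge0// mulr_sumr big_seq sumr_ge0// => w wu.
  by have [] := H _ wu.
under eq_bigr do rewrite bE mulrCA mulr_sumr.
rewrite -mulr_sumr exchange_big/= big_seq.
under eq_bigr do [rewrite (H _ _).2; last by []].
by rewrite -big_seq big_const_seq count_predT iter_addr_0 mulVf// pnatr_eq0.
Qed.

Definition basis_vec (i : nat) : 'rV[R]_n := \row_j (i == j :> nat)%:R.

Lemma cross_face_basis b (i : nat) (c : bool) (j : 'I_n) : i = j -> b j = c ->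
  cross_face b ((-1) ^+ c *: basis_vec i).
Proof.
move=> -> <-; have E k : (-1) ^+ b k * ((-1) ^+ b j *: basis_vec j) 0 k
    = (j == k)%:R :> R.
  rewrite !mxE; have [->|jk] := eqVneq j k.
    by rewrite eqxx mulr1 -signr_addb addbb.
  by rewrite (negbTE (_ : val j != val k)) ?mulr0// (inj_eq val_inj).
split; first by move=> k; rewrite E.
under eq_bigr do rewrite E.
by rewrite (bigD1 j)//= eqxx big1 ?addr0// => k /negbTE; rewrite eq_sym => ->.
Qed.

End LOneSphere.

(** Near each point some nonzero coordinate of [g] keeps its sign; compactness makes the radius [d]
    uniform. *)
Lemma local_sign (R : realType) n j (K : set 'rV[R]_n) (g : 'rV[R]_n -> 'rV[R]_j) :
  compact K -> {within K, continuous g} -> (forall v, K v -> g v != 0) ->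
  exists2 d : R, 0 < d & forall v, K v -> exists (i : 'I_j) (b : bool),
    forall w, K w -> `|v - w| < d -> g w 0 i != 0 /\ (0 < g w 0 i) = b.
Proof.
move=> cK /subspace_continuousP cg g0.
have /compact_near_coveringP/(_ _ (0 : R)^'+
  (fun d v => exists (i : 'I_j) (b : bool),
    forall w, K w -> `|v - w| < d -> g w 0 i != 0 /\ (0 < g w 0 i) = b)) := cK.
case.
  move=> x Kx; have [i gi] : exists i, g x 0 i != 0.
    have /eqP := g0 _ Kx; apply: contra_notP => /forallNP H.
    by apply/rowP => i; rewrite mxE; apply/eqP/negPn/negP/H.
  have cgi : (g w 0 i) @[w --> within K (nbhs x)] --> g x 0 i.
    exact: (cvg_comp _ _ (cg _ Kx) (@coord_continuous _ _ _ _ _ _)).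
  have := cgi _ (nbhsx_ballx (g x 0 i) `|g x 0 i| _).
  rewrite normr_gt0 => /(_ gi) /nbhs_ballP[r /= r0 rK].
  exists (ball x (r / 2), [set d | d < r / 2]).
    split; first by apply: nbhsx_ballx; rewrite divr_gt0.
    by apply: nbhs_right_lt; rewrite divr_gt0.
  move=> [v d] /= [xv dr]; exists i, (0 < g x 0 i) => w Kw vw.
  have : ball (g x 0 i) `|g x 0 i| (g w 0 i).
    apply: rK => //; rewrite -ball_normE/= in xv *.
    have := ler_distD v x w; move: xv vw dr; lra.
  rewrite -ball_normE/= => gxw; split.
    by apply: contraTneq gxw => ->; rewrite subr0 ltxx.
  move: gxw gi; case: (ltrgt0P (g x 0 i)) => // gx; rewrite ltr_distlC.
    by move=> /andP[+ _] _; rewrite subrr => ->.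
  by move=> /andP[_ +] _; rewrite subrr => /ltW; rewrite leNgt => /negbTE.
move=> e /= e0 H.
exists (e / 2); first by rewrite divr_gt0.
apply: H => /=; rewrite ?sub0r ?normrN ?gtr0_norm ?divr_gt0//.
by rewrite gtr_pMr// invf_lt1// ltr1n.
Qed.

Section BorsukUlam.
Variables (R : realType) (n : nat).
Implicit Types v : 'rV[R]_n.

(** An odd sign on nonzero vectors, used where a coordinate of [g] vanishes. *)
Definition leading_sign v : bool :=
  if [pick i | v 0 i != 0] is Some i then 0 < v 0 i else false.

Lemma leading_signN v : v != 0 -> leading_sign (- v) = ~~ leading_sign v.
Proof.
move=> v0; rewrite /leading_sign.
rewrite (@eq_pick _ _ (fun i => v 0 i != 0)); last first.
  by move=> i; rewrite /= mxE oppr_eq0.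
case: pickP => [i vi|H].
  by rewrite mxE oppr_gt0 -leNgt le_eqVlt (negbTE vi).
exfalso; move/eqP: v0; apply; apply/rowP => i; rewrite mxE.
by apply/eqP; move: (H i) => /negbFE.
Qed.

Theorem borsuk_ulam j (g : 'rV[R]_n -> 'rV[R]_j) : (j < n)%N ->
  {within @l1sphere R n, continuous g} ->
  ~ (forall v, l1sphere v -> g (- v) = - g v /\ g v != 0).
Proof.
move=> jn cg gP.
have [d d0 dP] := local_sign (@compact_l1sphere R n) cg (fun v Kv => (gP v Kv).2).
(* Coordinates out of range count as 0, so that [sg i] is an odd sign for every [i]. *)
pose gi i v : R := if insub i is Some i' then g v 0 i' else 0.
pose sg i v := if gi i v == 0 then leading_sign v else 0 < gi i v.
have sgN i v : l1sphere v -> sg i (- v) = ~~ sg i v.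
  move=> v1; have giN : gi i (- v) = - gi i v.
    rewrite /gi; case: insub => [i'|]; last by rewrite oppr0.
    by rewrite (gP _ v1).1 mxE.
  rewrite /sg giN oppr_eq0; case: ifPn => gi0; first exact/leading_signN/l1sphere_neq0.
  by rewrite oppr_gt0 -leNgt le_eqVlt (negbTE gi0).
pose c : R := 1 - n%:R^-1.
have n0 : (0 < n)%N by case: (n) jn.
have c0 : 0 <= c by rewrite subr_ge0 invf_le1 ?ltr0n// ler1n.
have c1 : `|c| < 1 by rewrite ger0_norm// gtrBl invr_gt0 ltr0n.
(* Facets have mesh at most 2; [M] subdivisions bring it below [d]. *)
have [M cM] : exists M, c ^+ M * 2 < d.
  have : c ^+ M @[M --> \oo] --> 0 by apply: cvg_expr.
  move=> /cvgrPdist_lt /(_ (d / 2)) []; first by rewrite divr_gt0.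
  move=> M _ /(_ M) /=; rewrite leqnn sub0r normrN ger0_norm ?exprn_ge0//.
  by move=> /(_ isT) H; exists M; rewrite -ltr_pdivlMr.
pose e := @basis_vec R n.
have faceP b k v : (k <= n)%N -> v \in face e b k -> cross_face (b \o val) v.
  move=> kn /mapP[i]; rewrite mem_rev mem_iota add0n => /andP[_ ik] ->.
  exact: (@cross_face_basis _ _ _ _ _ (Ordinal (leq_trans ik kn))).
have faceM b k : (k <= n)%N -> mesh_le (face e b k) 2.
  move=> kn v w /(faceP _ _ _ kn)/cross_face_l1 v1.
  move=> /(faceP _ _ _ kn)/cross_face_l1 w1.
  apply: le_trans (ler_normB _ _) _.
  by rewrite -[2]/(1 + 1) -{1}v1 -w1 lerD// norm_le_l1norm.
have faceS b k : size (face e b k) = k by rewrite size_map size_rev size_iota.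
pose alpha := iter M (@sd R _) (sign_cochain sg).
have iterD phi psi : iter M (@sd R _) (fun t => phi t (+) psi t) =
    fun t : seq 'rV[R]_n => iter M (@sd R _) phi t (+) iter M (@sd R _) psi t.
  by elim: (M) => //= m ->; rewrite sd_add.
have iterN phi : iter M (@sd R _) (fun t => phi (map -%R t)) =
    fun t : seq 'rV[R]_n => iter M (@sd R _) phi (map -%R t).
  by elim: (M) => //= m ->; rewrite sd_opp.
have iter_cobd phi : iter M (@sd R _) (cobd phi) =
    cobd (iter M (@sd R 'rV[R]_n) phi).
  by elim: (M) => //= m ->; rewrite sd_cobd.
have cE : c = 1 - n.-1.+1%:R^-1 by rewrite prednK.
(* The relation between [alpha], its antipode and the coboundary survives subdivision, so
   [cross_step] equates the pairings in consecutive degrees. *)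
have crossS k : (k < n)%N -> cross e k.+1 alpha = cross e k alpha.
  move=> kn; apply: cross_step => b; rewrite /alpha -iter_cobd.
  rewrite -[X in _ (+) X](congr1 (@^~ (face e b k.+1)) (iterN (sign_cochain sg))).
  rewrite -[LHS](congr1 (@^~ (face e b k.+1)) (iterD (sign_cochain sg)
    (fun t => sign_cochain sg (map -%R t)))).
  apply: (@eq_iter_sd _ _ _ n.-1 (cross_face (b \o val)) 2) => //.
  - exact: closed_bary_cross_face.
  - by rewrite faceS prednK.
  - by move=> v /(faceP _ _ _ kn).
  - exact: faceM.
  move=> t _ Dt _; apply: cobd_sign_cochain => i v /Dt /cross_face_l1.
  exact: sgN.
(* In the base case only the empty sequence occurs, which subdivision does not affect. *)
have cross1 k : (k <= n)%N -> cross e k alpha = true.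
  elim: k => [_|k IH kn]; last by rewrite crossS// IH// ltnW.
  by rewrite /= /alpha; elim: (M) => //= m ->.
have := cross1 n (leqnn n).
rewrite (@eq_cross _ _ _ _ _ (fun=> false)) ?cross0// => b.
transitivity (iter M (@sd R _) (fun=> false) (face e b n)); last first.
  suff -> : iter M (@sd R 'rV[R]_n) (fun=> false) = fun=> false by [].
  by elim: (M) => //= m ->; rewrite sd0.
apply: (@eq_iter_sd _ _ _ n.-1 (cross_face (b \o val)) 2) => //.
- exact: closed_bary_cross_face.
- by rewrite faceS prednK.
- by move=> v /(faceP _ _ _ (leqnn n)).
- exact: faceM.
(* A small simplex lies within [d] of its first vertex, so some [sg i] is constant on it;
   [i < j < n] makes [i] the index of a coboundary factor. *)
move=> [|v t]; rewrite faceS => ts Dt mt; first by rewrite -ts in jn.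
have [i [bi H]] := dP v (cross_face_l1 (Dt _ (mem_head _ _))).
apply: (@sign_cochain_eq0 _ _ _ i bi).
  by rewrite ts; apply: leq_ltn_trans jn.
move=> w wt.
have [] := H w (cross_face_l1 (Dt _ wt)).
  by apply: le_lt_trans cM; rewrite cE; apply: mt; rewrite ?mem_head.
by rewrite /sg /gi valK => /negbTE ->.
Qed.

End BorsukUlam.

(** * Signed powers and the genus *)

Section SignedPower.
Variable R : realType.
Implicit Types x y a r : R.

Lemma continuous_norm_powR a : 0 < a -> continuous (fun x => `|x| `^ a).
Proof.
move=> a0 x; have [->|x0] := eqVneq x 0.
  apply/cvgrPdist_lt => e e0; rewrite normr0 powR0 ?gt_eqF//.
  near=> y; rewrite sub0r normrN ger0_norm ?powR_ge0//.
  have -> : e = (e `^ a^-1) `^ a by rewrite -powRrM mulVf ?gt_eqF// powRr1// ltW.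
  rewrite gt0_ltr_powR ?nnegrE ?powR_ge0//.
  rewrite -normrN -[- y]sub0r; near: y.
  by apply: (@nbhsx_ballx _ _ (0 : R^o)); exact: powR_gt0.
apply: (@continuous_comp _ _ _ (@Num.norm R R) (fun y => y `^ a)).
  exact: norm_continuous.
apply: differentiable_continuous; apply/derivable1_diffP/derivable_powR.
by rewrite in_itv/= andbT normr_gt0.
Unshelve. all: by end_near. Qed.

Definition spow a x := Num.sg x * `|x| `^ a.

(** Powers of the positive and negative parts: a form whose continuity at 0 does not involve the
    jump of [Num.sg]. *)
Lemma spowE a x : 0 < a ->
  spow a x = `|(`|x| + x) / 2| `^ a - `|(`|x| - x) / 2| `^ a.
Proof.
move=> a0; have p0 : (0 : R) `^ a = 0 by rewrite powR0 ?gt_eqF.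
rewrite /spow; have [x0|x0|->] := ltrgt0P x.
- rewrite gtr0_sg// subrr mul0r normr0 p0 subr0 mul1r.
  by rewrite (_ : (x + x) / 2 = x) ?gtr0_norm//; lra.
- rewrite ltr0_sg// addNr mul0r normr0 p0 sub0r mulN1r.
  by rewrite (_ : (- x - x) / 2 = - x) ?gtr0_norm ?oppr_gt0//; lra.
- by rewrite sgr0 mul0r addr0 subr0 mul0r normr0 subrr.
Qed.

Lemma continuous_spow a : 0 < a -> continuous (spow a).
Proof.
move=> a0; rewrite (_ : spow a = fun x =>
    `|(`|x| + x) / 2| `^ a - `|(`|x| - x) / 2| `^ a); last first.
  by apply/funext => x; exact: spowE.
move=> x; apply: cvgB.
  apply: (@continuous_comp _ _ _ (fun x : R => (`|x| + x) / 2) (fun y => `|y| `^ a)).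
    by apply: cvgMr_tmp; apply: cvgD; [exact: norm_continuous|exact: cvg_id].
  exact: continuous_norm_powR.
apply: (@continuous_comp _ _ _ (fun x : R => (`|x| - x) / 2) (fun y => `|y| `^ a)).
  by apply: cvgMr_tmp; apply: cvgB; [exact: norm_continuous|exact: cvg_id].
exact: continuous_norm_powR.
Qed.

Lemma spowN a x : spow a (- x) = - spow a x.
Proof. by rewrite /spow sgrN normrN mulNr. Qed.

Lemma norm_spow a x : 0 < a -> `|spow a x| = `|x| `^ a.
Proof.
move=> a0; rewrite /spow normrM normr_sg (ger0_norm (powR_ge0 _ _)).
have [->|x0] /= := eqVneq x 0; last by rewrite mul1r.
by rewrite normr0 powR0 ?gt_eqF// mulr0.
Qed.

Lemma spowK a x : 0 < a -> spow a^-1 (spow a x) = x.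
Proof.
move=> a0; rewrite {1}/spow norm_spow// -powRrM mulfV ?gt_eqF// powRr1//.
rewrite /spow sgrM sgr_id; have [->|x0] := eqVneq x 0.
  by rewrite normr0 mulr0.
by rewrite [Num.sg (_ `^ _)]gtr0_sg ?powR_gt0 ?normr_gt0// mulr1 -numEsg.
Qed.

(** [t^r <= t] holds for the two ratios [x / (x + y)] and [y / (x + y)], which add up to 1. *)
Lemma powR_superadditive r x y : 1 <= r -> 0 <= x -> 0 <= y ->
  x `^ r + y `^ r <= (x + y) `^ r.
Proof.
move=> r1 x0 y0; have r0 : r != 0 by rewrite gt_eqF// (lt_le_trans ltr01).
have [->|xn] := eqVneq x 0; first by rewrite powR0// !add0r.
have [->|yn] := eqVneq y 0; first by rewrite powR0// !addr0.
have xp : 0 < x by rewrite lt_neqAle eq_sym xn.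
have yp : 0 < y by rewrite lt_neqAle eq_sym yn.
have s0 : 0 < x + y by exact: addr_gt0.
have H z : 0 < z -> z <= x + y -> z `^ r <= z / (x + y) * (x + y) `^ r.
  move=> z0 zs; rewrite -{1}[z](divfK (lt0r_neq0 s0)).
  apply: ge1r_powRZ => //; last exact: ltW.
  by rewrite divr_gt0//= ler_pdivrMr// mul1r.
apply: le_trans (lerD (H _ xp _) (H _ yp _)) _; rewrite ?lerDl ?lerDr//.
by rewrite -mulrDl -mulrDl divff ?mul1r ?gt_eqF.
Qed.

Lemma powR_midpoint r x y : 1 <= r -> 0 <= x -> 0 <= y ->
  ((x + y) / 2) `^ r <= (x `^ r + y `^ r) / 2.
Proof.
move=> r1 x0 y0.
have h : (0 <= 2^-1 :> R) && (2^-1 <= 1 :> R) by apply/andP; split; lra.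
have := @convex_powR R r r1 (Itv01 (andP h).1 (andP h).2) x y.
rewrite !inE /= !in_itv/= !andbT => /(_ x0 y0).
rewrite [X in X `^ _ <= _ -> _]convRE convRE /= /unstable.onem.
rewrite (_ : 1 - 2^-1 = 2^-1); last lra.
by rewrite -!mulrDr !(mulrC 2^-1).
Qed.

(** Equal signs: superadditivity and [2^-r <= 2^-1]. Opposite signs: convexity of the power. Oddness
    and symmetry reduce the rest to these. *)
Lemma spow_contract r x y : 1 <= r ->
  (`|x - y| / 2) `^ r <= `|spow r x - spow r y| / 2.
Proof.
move=> r1; have r0 : 0 < r by exact: lt_le_trans ltr01 r1.
have pos u : 0 <= u -> spow r u = u `^ r.
  move=> u0; rewrite /spow ger0_norm//; have [->|un] := eqVneq u 0.
    by rewrite sgr0 mul0r powR0// gt_eqF.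
  by rewrite gtr0_sg ?mul1r// lt_neqAle eq_sym un.
have same u v : 0 <= v -> v <= u ->
    (`|u - v| / 2) `^ r <= `|spow r u - spow r v| / 2.
  move=> v0 vu; have u0 := le_trans v0 vu.
  have uv : 0 <= u - v by rewrite subr_ge0.
  have := powR_superadditive r1 uv v0; rewrite subrK => H.
  rewrite !pos// (ger0_norm uv) ger0_norm; last first.
    by rewrite subr_ge0; move: H (powR_ge0 (u - v) r); lra.
  rewrite powRM ?invr_ge0//.
  have h2 : 2^-1 `^ r <= 2^-1 :> R.
    by rewrite ge1r_powR// invr_gt0 ltr0n/= invf_le1 ?ler1n// ltr0n.
  apply: le_trans (ler_wpM2l (powR_ge0 _ _) h2) _.
  by rewrite ler_wpM2r ?invr_ge0//; move: H; lra.
have opp u v : 0 <= u -> v <= 0 ->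
    (`|u - v| / 2) `^ r <= `|spow r u - spow r v| / 2.
  move=> u0 v0; have nv0 : 0 <= - v by rewrite oppr_ge0.
  rewrite -[spow r v]opprK -spowN opprK !pos// !ger0_norm ?addr_ge0 ?powR_ge0//.
  exact: powR_midpoint.
have sym u v : (`|u - v| / 2) `^ r <= `|spow r u - spow r v| / 2 ->
    (`|v - u| / 2) `^ r <= `|spow r v - spow r u| / 2.
  by rewrite distrC [`|spow r u - _|]distrC.
have neg u v : (`|- u - - v| / 2) `^ r <= `|spow r (- u) - spow r (- v)| / 2 ->
    (`|u - v| / 2) `^ r <= `|spow r u - spow r v| / 2.
  by rewrite !spowN -!opprD !normrN.
have [x0|/ltW x0] := leP 0 x; have [y0|/ltW y0] := leP 0 y.
- by have [xy|/ltW yx] := leP x y; [apply: sym|]; exact: same.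
- exact: opp.
- by apply: sym; exact: opp.
- by apply: neg; have [xy|/ltW yx] := leP x y; [|apply: sym];
    apply: same; rewrite ?oppr_ge0 ?lerN2.
Qed.

End SignedPower.

Section Genus.
Variable R : realType.

(** On the empty set the conditions on a test map are vacuous, even for maps into R^0. *)
Lemma genus_ge_nonempty n (B : set 'rV[R]_n) k :
  (0 < k)%N -> genus_ge B k -> B !=set0.
Proof.
move=> k0 /(_ 0%N k0) H; apply: contrapT => /set0P/negP/negPn/eqP B0.
apply: H; exists (fun=> 0); split; last by rewrite B0.
by apply: continuous_subspaceT; exact: cst_continuous.
Qed.

Lemma genus_ge_map n n' (B : set 'rV[R]_n) (B' : set 'rV[R]_n')
    (phi : 'rV[R]_n -> 'rV[R]_n') k :
  {within B, continuous phi} ->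
  (forall x, B x -> phi (- x) = - phi x /\ B' (phi x)) ->
  genus_ge B k -> genus_ge B' k.
Proof.
move=> cphi phiP gB j jk [g [cg gP]]; apply: (gB j jk).
exists (g \o phi); split.
  by apply: within_comp cg => // x /phiP[].
move=> x /phiP[phiN /gP[gN g0]]; split => //=.
by rewrite phiN gN.
Qed.

End Genus.

(** * Variational eigenvalues and their limits *)

Section Graph.
Variables (R : realType) (n : nat) (G : sgraph R n).
Hypothesis wfG : sgraph_wf G.
Implicit Types (f : 'rV[R]_n) (p : R).

Lemma mu_gt0 i : 0 < mu G i.
Proof. by case: wfG. Qed.

Lemma rq_den_opp p f : rq_den G p (- f) = rq_den G p f.
Proof. by apply: eq_bigr => i _; rewrite mxE normrN. Qed.

Lemma rq_denZ p c f : rq_den G p (c *: f) = `|c| `^ p * rq_den G p f.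
Proof.
rewrite /rq_den mulr_sumr; apply: eq_bigr => i _.
by rewrite mxE normrM powRM// mulrCA.
Qed.

Lemma rq_den_gt0 p f : f != 0 -> 0 < rq_den G p f.
Proof.
move=> f0; have [i fi] : exists i, f 0 i != 0.
  move/eqP: f0; apply: contra_notP => /forallNP H.
  by apply/rowP => i; rewrite mxE; apply/eqP/negPn/negP/H.
rewrite /rq_den (bigD1 i)//= ltr_pwDl//.
  by rewrite mulr_gt0 ?mu_gt0// powR_gt0// normr_gt0.
by apply: sumr_ge0 => j _; rewrite mulr_ge0 ?powR_ge0// ltW// mu_gt0.
Qed.

Lemma continuous_rq_den p : 0 < p -> continuous (rq_den G p).
Proof.
move=> p0; apply: continuous_big; first exact: add_continuous.
move=> i _ f.
apply: (@continuous_comp _ _ _ (fun f : 'rV[R]_n => f 0 i)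
    (fun y => mu G i * `|y| `^ p)); first exact: coord_continuous.
by apply: cvgM; [exact: cvg_cst|exact: continuous_norm_powR].
Qed.

Lemma closed_Sp p : 0 < p -> closed (Sp G p).
Proof.
move=> p0; apply: (@preimage_closed _ _ (rq_den G p) [set 1]).
  by move=> f _; exact: continuous_rq_den.
exact: closed_eq.
Qed.

Lemma genus_Sp p : 0 < p -> genus_ge (Sp G p) n.
Proof.
move=> p0 j jn [g [cg gP]].
(* Odd radial projection of the l1 sphere into S_p, which brings the claim back to Borsuk-Ulam. *)
pose pi f := (`|rq_den G p f| `^ p^-1)^-1 *: f.
have piP f : l1sphere f -> Sp G p (pi f).
  move=> /l1sphere_neq0/(rq_den_gt0 p) d0; rewrite /Sp/= rq_denZ normfV.
  rewrite (ger0_norm (powR_ge0 _ _)) (gtr0_norm d0) -powRN -powRrM mulNr.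
  by rewrite mulVf ?gt_eqF// powRN powRr1 ?(ltW d0)// mulVf// gt_eqF.
apply: (@borsuk_ulam R n j (g \o pi) jn).
  apply: within_comp cg => //; apply: continuous_in_subspaceT => f.
  rewrite inE => f1; pose N f := `|rq_den G p f| `^ p^-1.
  have cN : N f @[f --> f] --> N f.
    apply: (@continuous_comp _ _ _ (rq_den G p) (fun y => `|y| `^ p^-1)).
      exact: continuous_rq_den.
    by apply: continuous_norm_powR; rewrite invr_gt0.
  apply: (cvgZ _ (@cvg_id _ (nbhs f))); apply: (cvgV _ cN).
  by rewrite gt_eqF// powR_gt0// normr_gt0 gt_eqF// rq_den_gt0//; exact: l1sphere_neq0.
move=> f /piP Sf; rewrite /= /pi rq_den_opp scalerN; exact: gP.
Qed.

Lemma Fk_Sp p k : 0 < p -> (k <= n)%N -> Fk G p k (Sp G p).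
Proof.
move=> p0 kn; split=> //; split; first exact: closed_Sp.
split; first by move=> f; rewrite /Sp/= rq_den_opp.
by move=> j jk; apply: (genus_Sp p0); exact: leq_trans jk kn.
Qed.

(** On S_p each [|f_i|^p] is at most [1 / mu_i], so this bounds the potential term uniformly in
    p. *)
Definition kap_bound := \sum_i `|kap G i| / mu G i.

Lemma Sp_coord p f i : Sp G p f -> `|f 0 i| `^ p <= (mu G i)^-1.
Proof.
move=> f1; rewrite -[leRHS]mulr1 ler_pdivlMl ?mu_gt0// -f1 /rq_den.
rewrite (bigD1 i)//= lerDl.
by apply: sumr_ge0 => j _; rewrite mulr_ge0 ?powR_ge0// ltW// mu_gt0.
Qed.

Lemma kap_le p f : Sp G p f -> `|\sum_i kap G i * `|f 0 i| `^ p| <= kap_bound.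
Proof.
move=> f1; apply: le_trans (ler_norm_sum _ _ _) _; apply: ler_sum => i _.
by rewrite normrM (ger0_norm (powR_ge0 _ _)) ler_wpM2l// Sp_coord.
Qed.

Lemma rayleigh_Sp p f : Sp G p f -> rayleigh G p f = rq_num G p f.
Proof. by rewrite /rayleigh => ->; rewrite divr1. Qed.

Lemma edge_ge0 p f : 0 <= \sum_(i < n) \sum_(j < n | ((i < j)%N && adj G i j))
      wt G i j * `|f 0 i - sgn G i j * f 0 j| `^ p.
Proof.
apply: sumr_ge0 => i _; apply: sumr_ge0 => j /andP[_ ij].
by rewrite mulr_ge0 ?powR_ge0// ltW//; case: wfG => _ _ _ /(_ _ _ ij)[].
Qed.

Lemma rayleigh_ge p f : Sp G p f -> - kap_bound <= rayleigh G p f.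
Proof.
move=> f1; rewrite rayleigh_Sp// /rq_num.
have := edge_ge0 p f; have := kap_le f1; rewrite ler_norml => /andP[]; lra.
Qed.

Lemma norm_sgn i j : adj G i j -> `|sgn G i j| = 1.
Proof.
by move=> ij; case: wfG => _ _ /(_ _ _ ij)[[]-> _] _ _; rewrite ?normrN normr1.
Qed.

Lemma edge_powR_le p (x y s : R) : 0 <= p -> `|s| = 1 ->
  `|x - s * y| `^ p <= 2 `^ p * (`|x| `^ p + `|y| `^ p).
Proof.
move=> p0 s1.
have sy : `|s * y| = `|y| by rewrite normrM s1 mul1r.
have le (z : R) : `|x| <= `|z| -> `|y| <= `|z| ->
    `|x - s * y| `^ p <= 2 `^ p * `|z| `^ p.
  move=> xz yz; rewrite -powRM// ge0_ler_powR ?nnegrE ?mulr_ge0//.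
  by apply: le_trans (ler_normB _ _) _; rewrite sy; lra.
have [xy|/ltW yx] := leP `|x| `|y|.
  apply: le_trans (le y xy (lexx _)) _.
  by rewrite ?ler_wpM2l ?powR_ge0 ?lerDr ?powR_ge0.
apply: le_trans (le x (lexx _) yx) _.
by rewrite ?ler_wpM2l ?powR_ge0 ?lerDl ?powR_ge0.
Qed.

(** Ensures that the suprema in [lambda] are genuine and not the default value of [sup]. *)
Lemma rayleigh_le p : 0 <= p -> exists M, forall f, Sp G p f -> rayleigh G p f <= M.
Proof.
move=> p0; exists (\sum_(i < n) \sum_(j < n | ((i < j)%N && adj G i j))
  wt G i j * (2 `^ p * ((mu G i)^-1 + (mu G j)^-1)) + kap_bound) => f f1.
rewrite rayleigh_Sp//; apply: lerD; last exact: le_trans (ler_norm _) (kap_le f1).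
apply: ler_sum => i _; apply: ler_sum => j /andP[_ ij].
have w0 : 0 <= wt G i j by rewrite ltW//; case: wfG => _ _ _ /(_ _ _ ij)[].
rewrite ler_wpM2l//.
apply: le_trans (edge_powR_le _ _ p0 (norm_sgn ij)) _.
by rewrite ler_wpM2l ?powR_ge0// lerD// Sp_coord.
Qed.

Lemma sup_rayleigh_ge p k B f : Fk G p k B -> 0 <= p -> B f ->
  rayleigh G p f <= sup [set rayleigh G p f | f in B].
Proof.
move=> [BS _] p0 Bf; apply: ub_le_sup; last by exists f.
by have [M MP] := rayleigh_le p0; exists M => _ [u /BS Su <-]; exact: MP.
Qed.

Lemma lambda_has_inf p k : 0 < p -> (0 < k <= n)%N ->
  has_inf [set sup [set rayleigh G p f | f in B] | B in Fk G p k].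
Proof.
move=> p0 /andP[k0 kn]; split.
  by eexists; exists (Sp G p); first exact: Fk_Sp.
exists (- kap_bound) => _ [B FB <-].
have [f Bf] := genus_ge_nonempty k0 FB.2.2.2.
by apply: le_trans (sup_rayleigh_ge FB (ltW p0) Bf); exact: rayleigh_ge (FB.1 _ Bf).
Qed.

Lemma lambda_ge p k : 0 < p -> (0 < k <= n)%N -> - kap_bound <= lambda G p k.
Proof.
move=> p0 /[dup] kn /andP[k0 _]; apply: lb_le_inf.
  exact: (lambda_has_inf p0 kn).1.
move=> _ [B FB <-]; have [f Bf] := genus_ge_nonempty k0 FB.2.2.2.
by apply: le_trans (sup_rayleigh_ge FB (ltW p0) Bf); exact: rayleigh_ge (FB.1 _ Bf).
Qed.

End Graph.

Section Transfer.
Variables (R : realType) (n n' : nat) (G : sgraph R n) (G' : sgraph R n').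
Hypotheses (wfG : sgraph_wf G) (wfG' : sgraph_wf G').

(** Common scheme of the comparisons in p, under zero extension and under slicing: each competitor
    [B] yields a competitor [B'] whose quotients are dominated by those on [B]. *)
Lemma lambda_transfer (p p' : R) k k' a c : 0 < p -> 0 < p' -> 0 < a ->
  (0 < k <= n)%N -> (0 < k' <= n')%N ->
  (forall B, Fk G p k B -> exists2 B', Fk G' p' k' B' &
     forall f', B' f' ->
       exists2 f, B f & rayleigh G' p' f' <= a * rayleigh G p f + c) ->
  lambda G' p' k' <= a * lambda G p k + c.
Proof.
move=> p0 p'0 a0 kn kn' H; rewrite -lerBlDr -ler_pdivrMl//.
apply: lb_le_inf; first exact: (lambda_has_inf wfG p0 kn).1.
move=> _ [B FB <-]; rewrite ler_pdivrMl// lerBlDr.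
have [B' FB' HB'] := H _ FB.
apply: le_trans (_ : sup [set rayleigh G' p' f | f in B'] <= _).
  by apply: ge_inf; [exact: (lambda_has_inf wfG' p'0 kn').2|exists B'].
apply: ge_sup.
  have [f Bf] := genus_ge_nonempty (andP kn').1 FB'.2.2.2.
  by exists (rayleigh G' p' f), f.
move=> _ [f' /HB'[f Bf ff'] <-]; apply: le_trans ff' _.
by rewrite lerD2r ler_pM2l// (sup_rayleigh_ge wfG FB (ltW p0)).
Qed.

End Transfer.

(** * Almost monotonicity in p and existence of the limits *)

Section Limit.
Variables (R : realType) (n : nat) (G : sgraph R n).
Hypothesis wfG : sgraph_wf G.

Definition spow_row (a : R) (f : 'rV[R]_n) : 'rV[R]_n := \row_i spow a (f 0 i).

Lemma continuous_spow_row a : 0 < a -> continuous (spow_row a).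
Proof.
move=> a0 f; apply: (@cvg_row _ _ (nbhs f)) => i.
rewrite mxE; under eq_fun do rewrite mxE.
apply: (@continuous_comp _ _ _ (fun f : 'rV[R]_n => f 0 i) (spow a)).
  exact: coord_continuous.
exact: continuous_spow.
Qed.

Lemma spow_rowN a f : spow_row a (- f) = - spow_row a f.
Proof. by apply/rowP => i; rewrite !mxE spowN. Qed.

Lemma spow_rowK a f : 0 < a -> spow_row a^-1 (spow_row a f) = f.
Proof. by move=> a0; apply/rowP => i; rewrite !mxE spowK. Qed.

Lemma rq_den_spow_row p q f : 0 < p -> 0 < q ->
  rq_den G p (spow_row (q / p) f) = rq_den G q f.
Proof.
move=> p0 q0; apply: eq_bigr => i _.
by rewrite mxE norm_spow ?divr_gt0// -powRrM divfK// gt_eqF.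
Qed.

(** [spow_row (q / p)] is an odd homeomorphism carrying S_q onto S_p; its inverse [spow_row (p / q)]
    transports the genus. *)
Lemma Fk_spow_row p q k B : 0 < p -> 0 < q -> Fk G p k B ->
  Fk G q k (spow_row (q / p) @^-1` B).
Proof.
move=> p0 q0 [BS [cB [sB gB]]]; have r0 : 0 < q / p by rewrite divr_gt0.
split; first by move=> f /BS; rewrite /Sp/= rq_den_spow_row.
split.
  by apply: preimage_closed cB => f _; exact: continuous_spow_row.
split; first by move=> f /sB; rewrite /preimage/= spow_rowN.
apply: (genus_ge_map (phi := spow_row (p / q))) gB.
  by apply: continuous_subspaceT; apply: continuous_spow_row; rewrite divr_gt0.
move=> f Bf; rewrite spow_rowN; split=> //.
by rewrite /preimage/= -[q / p]invf_div spow_rowK// divr_gt0.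
Qed.

(** The edge terms follow from [spow_contract] raised to the power [p]. The potential sum is the
    same on both sides and at least [- kap_bound G], so the last term pays for multiplying it by
    [2^(q - p) >= 1]. *)
Lemma rayleigh_spow_row p q f : 0 < p -> p <= q -> Sp G q f ->
  rayleigh G q f <= 2 `^ (q - p) * rayleigh G p (spow_row (q / p) f)
    + kap_bound G * (2 `^ (q - p) - 1).
Proof.
move=> p0 pq Sf; have q0 := lt_le_trans p0 pq.
have SF : Sp G p (spow_row (q / p) f) by rewrite /Sp/= rq_den_spow_row.
rewrite !rayleigh_Sp// /rq_num.
have -> : \sum_i kap G i * `|spow_row (q / p) f 0 i| `^ p =
          \sum_i kap G i * `|f 0 i| `^ q.
  apply: eq_bigr => i _.
  by rewrite mxE norm_spow ?divr_gt0// -powRrM divfK// gt_eqF.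
have r1 : 1 <= q / p by rewrite ler_pdivlMr// mul1r.
rewrite mulrDr -addrA; apply: lerD.
  rewrite mulr_sumr; apply: ler_sum => i _.
  rewrite mulr_sumr; apply: ler_sum => j /andP[_ ij].
  have w0 : 0 <= wt G i j by rewrite ltW//; case: wfG => _ _ _ /(_ _ _ ij)[].
  rewrite mulrCA ler_wpM2l// !mxE.
  have -> : sgn G i j * spow (q / p) (f 0 j) = spow (q / p) (sgn G i j * f 0 j).
    by case: wfG => _ _ /(_ _ _ ij)[[]-> _] _ _; rewrite ?mulN1r ?mul1r ?spowN.
  set x := f 0 i; set y := _ * f 0 j.
  have := spow_contract x y r1 => H.
  have {}H : ((`|x - y| / 2) `^ (q / p)) `^ p <=
      (`|spow (q / p) x - spow (q / p) y| / 2) `^ p.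
    by rewrite ge0_ler_powR ?nnegrE ?powR_ge0 ?divr_ge0// ltW.
  move: H; rewrite -powRrM divfK ?gt_eqF// !powRM ?invr_ge0//.
  rewrite -(powR_inv1 (ler0n _ 2)) -!powRrM !mulN1r => H.
  have := ler_wpM2l (powR_ge0 2 q) H.
  rewrite mulrCA -powRD ?subrr ?powRr0 ?mulr1 ?pnatr_eq0 ?implybT//.
  move=> /le_trans; apply; rewrite powRD ?pnatr_eq0 ?implybT//.
  by rewrite -mulrA [X in _ * X]mulrC.
have K := kap_le wfG Sf; move: K; set K := \sum_i _.
have : 1 <= 2 `^ (q - p) :> R.
  have := @ler_powR R 2 _ 0 (q - p); rewrite powRr0.
  apply; last by rewrite subr_ge0.
  by rewrite ler1n.
rewrite ler_norml; move: (2 `^ (q - p)) => t; nra.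
Qed.

Lemma lambda_monotone p q k : 0 < p -> p <= q -> (0 < k <= n)%N ->
  lambda G q k <= 2 `^ (q - p) * lambda G p k + kap_bound G * (2 `^ (q - p) - 1).
Proof.
move=> p0 pq kn; have q0 := lt_le_trans p0 pq.
apply: (lambda_transfer wfG wfG p0 q0 _ kn kn); first by rewrite powR_gt0.
move=> B FB; have FB' := Fk_spow_row p0 q0 FB.
exists (spow_row (q / p) @^-1` B) => // f Bf.
by exists (spow_row (q / p) f) => //; apply: rayleigh_spow_row => //; exact: FB'.1.
Qed.

Lemma cvg_powR2N : (2 : R) `^ (- p) @[p --> +oo] --> (0 : R).
Proof.
have E : (fun p : R => 2 `^ (- p)) = (fun p => expR (- p)) \o (fun p => p * ln 2).
  by apply/funext => p /=; rewrite /powR pnatr_eq0/= mulNr.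
rewrite E; apply: cvg_comp; last exact: cvgr_expR.
by apply: gt0_cvgMly; [rewrite ln_gt0// ltr1n|exact: cvg_id].
Qed.

Lemma is_cvg_Lcut k : (0 < k <= n)%N ->
  cvg (2 `^ (- p) * lambda G p k @[p --> +oo]).
Proof.
move=> kn; pose C := kap_bound G.
(* The shift by [C] absorbs the error in [lambda_monotone] and makes [u] nonnegative and
   nonincreasing. *)
pose u p := 2 `^ (- p) * (lambda G p k + C).
have u_noninc p q : 0 < p -> p <= q -> u q <= u p.
  move=> p0 pq; rewrite /u.
  have -> : 2 `^ (- p) = 2 `^ (- q) * 2 `^ (q - p) :> R.
    by rewrite -powRD ?pnatr_eq0 ?implybT// addrA addNr add0r.
  rewrite -mulrA ler_wpM2l ?powR_ge0//.
  by have := lambda_monotone p0 pq kn; rewrite -/C; lra.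
have u_ge0 p : 0 < p -> 0 <= u p.
  move=> p0; rewrite mulr_ge0 ?powR_ge0//.
  by have := lambda_ge wfG p0 kn; rewrite -/C; lra.
have cu : cvg (u p @[p --> +oo]).
  (* Freezing [u] below p = 1 and changing its sign gives a function nondecreasing on the whole
     line. *)
  pose v p := - u (Num.max 1 p).
  have m0 p : 0 < Num.max 1 p :> R by rewrite lt_max ltr01.
  have cv : cvg (v p @[p --> +oo]).
    apply/cvg_ex; eexists; apply: nondecreasing_cvgr.
      move=> p q pq; rewrite lerN2; apply: u_noninc => //.
      by rewrite ge_max !le_max lexx pq orbT.
    by exists 0 => _ [p _ <-]; rewrite oppr_le0 u_ge0.
  apply: (cvgP (- lim (v p @[p --> +oo]))).
  apply: (@cvg_trans _ ((- v p) @[p --> +oo])); last exact: cvgN.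
  apply: near_eq_cvg; near=> p; rewrite /v opprK; congr u.
  by rewrite max_r//; near: p; apply: nbhs_pinfty_ge; rewrite num_real.
apply: (cvgP (lim (u p @[p --> +oo]) - 0 * C)).
have -> : (fun p : R => 2 `^ (- p) * lambda G p k) =
    (fun p => u p - 2 `^ (- p) * C).
  by apply/funext => p; rewrite /u mulrDr addrK.
by apply: cvgB => //; apply: cvgMr_tmp; exact: cvg_powR2N.
Unshelve. all: by end_near. Qed.

End Limit.

(** * Removing vertices *)

Section ZeroExtension.
Variables (R : realType) (n n' : nat) (h : 'I_n' -> 'I_n).
Hypothesis h_inj : injective h.

(** For injective [h] the sum has one term on the image of [h] and none elsewhere. *)
Definition zero_ext (f : 'rV[R]_n') : 'rV[R]_n :=
  \row_i \sum_(i' | h i' == i) f 0 i'.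

Lemma zero_ext_im f i' : zero_ext f 0 (h i') = f 0 i'.
Proof.
rewrite mxE (bigD1 i')//= big1 ?addr0// => j /andP[/eqP/h_inj ->].
by rewrite eqxx.
Qed.

Lemma zero_ext_out f i : i \notin codom h -> zero_ext f 0 i = 0.
Proof.
move=> ih; rewrite mxE big1// => j /eqP hj.
by move: ih; rewrite -hj codom_f.
Qed.

Lemma zero_extN f : zero_ext (- f) = - zero_ext f.
Proof.
by apply/rowP => i; rewrite !mxE -sumrN; apply: eq_bigr => j _; rewrite mxE.
Qed.

Lemma continuous_zero_ext : continuous zero_ext.
Proof.
move=> f; apply: (@cvg_row _ _ (nbhs f)) => i.
rewrite mxE; under eq_fun do rewrite mxE.
apply: cvg_big; first exact: add_continuous.
by move=> j _; exact: coord_continuous.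
Qed.

Lemma sum_codom (F : 'I_n -> R) :
  \sum_i F i = \sum_i' F (h i') + \sum_(i | i \notin codom h) F i.
Proof.
rewrite (bigID (fun i => i \in codom h))/=; congr (_ + _).
rewrite -(big_imset F (in2W h_inj)); apply: eq_bigl => i.
by apply/codomP/imsetP => [[j ->]|[j _ ->]]; exists j.
Qed.

(* [f] vanishes off [codom h] on the slice of [B], so a map into R^j without
   zeros on the slice, extended to [B] by Tietze and paired with the
   coordinates off [codom h], has no zeros on [B]. *)
Lemma genus_ge_slice (B : set 'rV[R]_n) k :
  closed B -> symmetric_set B ->
  genus_ge B (k + #|[predC codom h]|) -> genus_ge (zero_ext @^-1` B) k.
Proof.
move=> cB sB gB j jk [g [cg gP]].
pose r (f : 'rV[R]_n) : 'rV[R]_n' := \row_i f 0 (h i).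
pose A := [predC codom h].
pose D : set 'rV[R]_n := B `&`
  \bigcap_(i in [set` A]) ((fun f : 'rV[R]_n => f 0 i) @^-1` [set 0]).
have rK f : D f -> zero_ext (r f) = f.
  move=> [_ f0]; apply/rowP => i.
  have [/codomP[i' ->]|ih] := boolP (i \in codom h).
    by rewrite zero_ext_im mxE.
  by rewrite zero_ext_out// f0.
have cr : continuous r.
  move=> f; apply: (@cvg_row _ _ (nbhs f)) => i.
  by rewrite mxE; under eq_fun do rewrite mxE; exact: coord_continuous.
have cD : closed D.
  apply: closedI => //.
  apply: closed_bigI => i _; apply: preimage_closed; last exact: closed_eq.
  by move=> f _; exact: coord_continuous.
(* Normalizing bounds the coordinates by 1 on [D], as the bounded form of Tietze's theorem
   requires. *)
pose g1 f := `|g (r f)|^-1 *: g (r f).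
have rD f : D f -> (zero_ext @^-1` B) (r f).
  by move=> Df; rewrite /preimage/= rK//; case: Df.
have cgr : {within D, continuous (g \o r)}.
  by apply: within_comp cg => //; exact: continuous_subspaceT.
have cg1 i : {within D, continuous (fun f => g1 f 0 i)}.
  apply/subspace_continuousP => f Df.
  have cgf : (g \o r) x @[x --> within D (nbhs f)] --> (g \o r) f.
    by move/subspace_continuousP: cgr; apply.
  have H : `|(g \o r) x|^-1 * (g \o r) x 0 i @[x --> within D (nbhs f)] -->
      `|(g \o r) f|^-1 * (g \o r) f 0 i.
    apply: cvgM; last exact: (cvg_comp _ _ cgf (@coord_continuous _ _ _ _ _ _)).
    apply: cvgV; last exact: cvg_norm.
    by rewrite normr_eq0; have [] := gP _ (rD _ Df).
  rewrite (_ : (fun f => g1 f 0 i) = fun x => `|(g \o r) x|^-1 * (g \o r) x 0 i)//.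
  by apply/funext => x; rewrite mxE.
have Tietze i := continuous_bounded_extension (@pseudometric_normal R 'rV[R]_n)
  cD ltr01 (cg1 i).
have /choice[G GP] : forall i, exists G : 'rV[R]_n -> R,
    {in D, (fun f => g1 f 0 i) =1 G} /\ continuous G.
  move=> i; have [|G [GE cG _]] := Tietze i; last by exists G.
  move=> f Df; have g0 := (gP _ (rD _ Df)).2.
  rewrite mxE normrM normfV normr_id ler_pdivrMl ?normr_gt0// mulr1.
  rewrite [leRHS]/Num.norm/= mx_normrE.
  by apply/bigmax_geP; right; exists (0, i).
pose c : 'I_#|A| -> 'I_n := enum_val.
(* Antisymmetrizing makes the extension odd; on [D], where [g1] is already odd, it gives twice
   [g1]. *)
pose H (f : 'rV[R]_n) : 'rV[R]_(j + #|A|) :=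
  row_mx (\row_i (G i f - G i (- f))) (\row_l f 0 (c l)).
apply: (gB (j + #|A|)%N); first by rewrite ltn_add2r.
exists H; split.
  apply: continuous_subspaceT => f; apply: (@cvg_row _ _ (nbhs f)) => i.
  rewrite mxE; under eq_fun do rewrite mxE.
  case: split_ordP => l _; rewrite mxE; under eq_fun do rewrite mxE.
    have [_ cG] := GP l; apply: cvgB; first exact: cG.
    apply: (@continuous_comp _ _ _ (fun f : 'rV[R]_n => - f) (G l)).
      exact: opp_continuous.
    exact: cG.
  exact: coord_continuous.
move=> f Bf; split.
  apply/rowP => i; rewrite /H !mxE; case: split_ordP => l _; rewrite !mxE//.
  by rewrite opprK opprB.
(* At a zero of [H] the last coordinates force [f] into [D], and the first ones then contradict
   [g != 0]. *)
apply/eqP => H0.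
have Df : D f.
  split=> // i iA; have /rowP/(_ (rshift j (enum_rank_in iA i))) := H0.
  by rewrite row_mxEr !mxE /c enum_rankK_in.
have DNf : D (- f).
  by split; [exact: sB|move=> i /Df.2 /= fi; rewrite /= mxE fi oppr0].
have [gN g0] := gP _ (rD _ Df).
have rN : r (- f) = - r f by apply/rowP => i; rewrite !mxE.
move/eqP: g0; apply; apply/rowP => i; rewrite mxE.
have /rowP/(_ (lshift #|A| i)) := H0.
rewrite row_mxEl !mxE -!(GP i).1 ?inE// /g1 rN gN normrN !mxE mulrN opprK -mulr2n.
move/eqP; rewrite mulrn_eq0/= mulf_eq0 invr_eq0 normr_eq0 => /orP[|/eqP//].
by move=> /eqP ->; rewrite mxE.
Qed.

End ZeroExtension.

(** * Comparison with an induced subgraph *)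

Section Induced.
Variables (R : realType) (n n' : nat) (G : sgraph R n) (h : 'I_n' -> 'I_n).
Hypotheses (wfG : sgraph_wf G) (h_inj : injective h).
Notation G' := (sg_induced G h).
Notation E := (zero_ext h).

Lemma sgraph_wf_induced : sgraph_wf G'.
Proof.
case: wfG => asym airr sK wK mu0; split => /= *.
- exact: asym.
- exact: airr.
- exact: sK.
- exact: wK.
- exact: mu0.
Qed.

(** [h] may not preserve the order of vertices, so sums over [i < j] do not restrict well; sums over
    ordered pairs do, counting each edge twice. *)
Lemma sum_edges m (K : sgraph R m) (F : 'I_m -> 'I_m -> R) : sgraph_wf K ->
  (forall i j, adj K i j -> F i j = F j i) ->
  \sum_i \sum_(j | adj K i j) F i j =
  (\sum_(i < m) \sum_(j < m | (i < j)%N && adj K i j) F i j) *+ 2.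
Proof.
move=> [asym airr _ _ _] FC.
transitivity (\sum_(i < m) (\sum_(j < m | (i < j)%N && adj K i j) F i j +
    \sum_(j < m | (j < i)%N && adj K i j) F i j)).
  apply: eq_bigr => i _; rewrite (bigID (fun j : 'I_m => (i < j)%N))/=.
  congr (_ + _); apply: eq_bigl => j; first by rewrite andbC.
  rewrite andbC -leqNgt leq_eqVlt; case: eqVneq => //= ji.
  by rewrite (val_inj ji) (negbTE (airr i)) andbF.
rewrite big_split/= mulr2n; congr (_ + _).
rewrite (exchange_big_dep xpredT)//=; apply: eq_bigr => j _.
by apply: eq_big => [i|i /andP[_ ij]]; [rewrite asym|exact: FC].
Qed.

Definition edge_term m (K : sgraph R m) p (f : 'rV[R]_m) i j :=
  wt K i j * `|f 0 i - sgn K i j * f 0 j| `^ p.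

Lemma edge_termC m (K : sgraph R m) p f i j : sgraph_wf K -> adj K i j ->
  edge_term K p f i j = edge_term K p f j i.
Proof.
move=> [_ _ sK wK _] ij; have [s1 sC] := sK _ _ ij; have [_ wC] := wK _ _ ij.
rewrite /edge_term wC -sC; congr (_ * _ `^ _).
case: s1 => ->; first by rewrite !mul1r distrC.
by rewrite !mulN1r !opprK addrC.
Qed.

Lemma rq_numE m (K : sgraph R m) p f : sgraph_wf K ->
  rq_num K p f = (\sum_i \sum_(j | adj K i j) edge_term K p f i j) / 2 +
    \sum_i kap K i * `|f 0 i| `^ p.
Proof.
move=> wK; rewrite (sum_edges wK) => [|i j ij]; last exact: edge_termC.
by rewrite -[X in X / 2]mulr_natr mulfK// pnatr_eq0.
Qed.

Lemma sum_zero_ext (a : 'I_n -> R) p f : p != 0 ->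
  \sum_i a i * `|E f 0 i| `^ p = \sum_i a (h i) * `|f 0 i| `^ p.
Proof.
move=> p0; rewrite (sum_codom h_inj) [X in _ + X]big1 ?addr0.
  by apply: eq_bigr => i _; rewrite zero_ext_im.
by move=> i ih; rewrite zero_ext_out// normr0 powR0// mulr0.
Qed.

Lemma rq_den_zero_ext p f : p != 0 -> rq_den G p (E f) = rq_den G' p f.
Proof. exact: sum_zero_ext. Qed.

Lemma edge_term_ge0 p f i j : adj G i j -> 0 <= edge_term G p f i j.
Proof.
move=> ij; rewrite mulr_ge0 ?powR_ge0// ltW//.
by case: wfG => _ _ _ /(_ _ _ ij)[].
Qed.

Lemma edge_term_zero_ext p f i j :
  edge_term G p (E f) (h i) (h j) = edge_term G' p f i j.
Proof. by rewrite /edge_term !zero_ext_im. Qed.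

(** Edges with a removed endpoint contribute nonnegative terms; all other terms agree. *)
Lemma rayleigh_zero_ext_ge p f : p != 0 -> Sp G' p f ->
  rayleigh G' p f <= rayleigh G p (E f).
Proof.
move=> p0 Sf; have SE : Sp G p (E f) by rewrite /Sp/= rq_den_zero_ext.
rewrite !rayleigh_Sp// !rq_numE//; last exact: sgraph_wf_induced.
rewrite sum_zero_ext// lerD2r ler_pM2r ?invr_gt0//.
have edge_ge0 i : 0 <= \sum_(j | adj G i j) edge_term G p (E f) i j.
  by apply: sumr_ge0 => j; exact: edge_term_ge0.
rewrite (sum_codom h_inj); apply: ler_wpDr; first exact: sumr_ge0.
apply: ler_sum => i _; rewrite [leRHS]big_mkcond (sum_codom h_inj).
apply: ler_wpDr.
  by apply: sumr_ge0 => j _; case: ifP => // /(edge_term_ge0 p (E f)).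
rewrite [leLHS]big_mkcond; apply: ler_sum => j _ /=.
by rewrite edge_term_zero_ext.
Qed.

(** On an edge with a removed endpoint [E f] has a zero, so the term is at most the weight times
    [|f|^p] at the other endpoint, bounded on S_p independently of p. Summing over all edges is
    crude but enough. *)
Definition cut_bound := (\sum_i \sum_(j | adj G i j)
  wt G i j * ((mu G i)^-1 + (mu G j)^-1)) / 2.

Lemma rayleigh_zero_ext_le p f : p != 0 -> Sp G' p f ->
  rayleigh G p (E f) <= rayleigh G' p f + cut_bound.
Proof.
move=> p0 Sf; have SE : Sp G p (E f) by rewrite /Sp/= rq_den_zero_ext.
rewrite !rayleigh_Sp// !rq_numE//; last exact: sgraph_wf_induced.
rewrite sum_zero_ext// addrAC lerD2r -mulrDl ler_pM2r ?invr_gt0//.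
have -> : \sum_i \sum_(j | adj G' i j) edge_term G' p f i j =
    \sum_(i in codom h) \sum_(j | adj G i j && (j \in codom h))
      edge_term G p (E f) i j.
  rewrite [RHS]big_mkcond (sum_codom h_inj) [X in _ + X]big1 ?addr0; last first.
    by move=> i /negbTE ->.
  apply: eq_bigr => i _; rewrite codom_f.
  rewrite [RHS]big_mkcond (sum_codom h_inj) [X in _ + X]big1 ?addr0; last first.
    by move=> j /negbTE ->; rewrite andbF.
  rewrite [LHS]big_mkcond; apply: eq_bigr => j _.
  by rewrite codom_f andbT edge_term_zero_ext.
rewrite [X in _ <= X + _]big_mkcond -big_split/=; apply: ler_sum => i _.
have w0 j : adj G i j -> 0 <= wt G i j.
  by move=> ij; rewrite ltW//; case: wfG => _ _ _ /(_ _ _ ij)[].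
have b0 j : 0 <= (mu G i)^-1 + (mu G j)^-1.
  by rewrite addr_ge0 ?invr_ge0 ?ltW ?(mu_gt0 wfG).
have out j : adj G i j -> (i \notin codom h) || (j \notin codom h) ->
    edge_term G p (E f) i j <= wt G i j * ((mu G i)^-1 + (mu G j)^-1).
  move=> ij oh; rewrite ler_wpM2l ?w0//.
  case/orP: oh => oh; rewrite (zero_ext_out _ oh).
    rewrite sub0r normrN normrM (norm_sgn wfG ij) mul1r.
    by rewrite ler_wpDl ?invr_ge0 ?(ltW (mu_gt0 wfG _))//; exact: Sp_coord.
  rewrite mulr0 subr0.
  by rewrite ler_wpDr ?invr_ge0 ?(ltW (mu_gt0 wfG _))//; exact: Sp_coord.
case: ifPn => ih; last first.
  by rewrite add0r; apply: ler_sum => j ij; apply: out => //; rewrite ih.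
rewrite (bigID (fun j => j \in codom h))/= lerD2l.
rewrite [leRHS](bigID (fun j => j \in codom h))/=.
apply: ler_wpDl.
  by apply: sumr_ge0 => j /andP[ij _]; rewrite mulr_ge0 ?w0.
by apply: ler_sum => j /andP[ij jh]; apply: out => //; rewrite jh orbT.
Qed.

Lemma Fk_zero_ext p k B : 0 < p -> Fk G' p k B -> Fk G p k (E @` B).
Proof.
move=> p0 [BS [cB [sB gB]]].
(* This writes the image as an intersection of preimages of closed sets under continuous maps. *)
have EB f : (E @` B) f <->
    B (\row_i f 0 (h i)) /\ forall i, i \notin codom h -> f 0 i = 0.
  split=> [[f' Bf' <-]|[Bf f0]].
    split; last by move=> i; exact: zero_ext_out.
    by rewrite (_ : \row_i _ = f')//; apply/rowP => i; rewrite mxE zero_ext_im.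
  exists (\row_i f 0 (h i)) => //; apply/rowP => i.
  have [/codomP[i' ->]|ih] := boolP (i \in codom h).
    by rewrite zero_ext_im// mxE.
  by rewrite zero_ext_out// f0.
split; first by move=> _ [f /BS Sf <-]; rewrite /Sp/= rq_den_zero_ext// gt_eqF.
split.
  rewrite (_ : E @` B = ((fun f : 'rV[R]_n => \row_i f 0 (h i)) @^-1` B) `&`
    \bigcap_(i in [set i | i \notin codom h])
      ((fun f : 'rV[R]_n => f 0 i) @^-1` [set 0])); last first.
    apply/seteqP; split => f.
      by move=> /EB[Bf f0]; split => // i /= /f0.
    by move=> [Bf f0]; apply/EB; split => // i /f0.
  apply: closedI.
    apply: preimage_closed cB => f _; apply: (@cvg_row _ _ (nbhs f)) => i.
    by rewrite mxE; under eq_fun do rewrite mxE; exact: coord_continuous.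
  apply: closed_bigI => i _; apply: preimage_closed; last exact: closed_eq.
  by move=> f _; exact: coord_continuous.
split; first by move=> _ [f /sB Bf <-]; exists (- f) => //; rewrite zero_extN.
apply: (genus_ge_map (phi := E)) gB.
  exact/continuous_subspaceT/continuous_zero_ext.
by move=> f Bf; rewrite zero_extN; split => //; exists f.
Qed.

Lemma card_predC_codom : #|[predC codom h]| = (n - n')%N.
Proof.
have := cardC (mem (codom h)); rewrite card_codom// !card_ord => E.
by rewrite -[in RHS]E addKn.
Qed.

Lemma lambda_le_induced p k : 0 < p -> (n' <= n)%N -> (0 < k <= n')%N ->
  lambda G p k <= lambda G' p k + cut_bound.
Proof.
move=> p0 nn /andP[k0 kn]; rewrite -[lambda G' p k]mul1r.
apply: (lambda_transfer sgraph_wf_induced wfG p0 p0 ltr01); rewrite ?k0//=.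
  exact: leq_trans nn.
move=> B FB; exists (E @` B); first exact: Fk_zero_ext.
move=> _ [f Bf <-]; exists f => //; rewrite mul1r.
by apply: rayleigh_zero_ext_le; [rewrite gt_eqF|exact: FB.1].
Qed.

Lemma induced_le_lambda p k : 0 < p -> (n' <= n)%N -> (0 < k <= n')%N ->
  lambda G' p k <= lambda G p (k + (n - n')).
Proof.
move=> p0 nn /andP[k0 kn].
rewrite -[leRHS]addr0 -[lambda G p _]mul1r.
apply: (lambda_transfer wfG sgraph_wf_induced p0 p0 ltr01); rewrite ?k0//=.
  by rewrite addn_gt0 k0/= -[leqRHS](subnKC nn) leq_add2r.
move=> B [BS [cB [sB gB]]]; exists (E @^-1` B).
  split; first by move=> f /BS; rewrite /Sp/= rq_den_zero_ext// gt_eqF.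
  split; first by apply: preimage_closed cB => f _; exact: continuous_zero_ext.
  split; first by move=> f /sB; rewrite /preimage/= zero_extN.
  by apply: genus_ge_slice => //; rewrite card_predC_codom.
move=> f Bf; exists (E f) => //; rewrite mul1r addr0.
apply: rayleigh_zero_ext_ge; rewrite ?gt_eqF//.
by have := BS _ Bf; rewrite /Sp/= rq_den_zero_ext// gt_eqF.
Qed.

End Induced.

Theorem theorem4p6 (R : realType) (n m : nat) (G : sgraph R n)
    (h : 'I_(n - m) -> 'I_n) :
  sgraph_wf G -> injective h ->
  (1 <= m <= n - 1)%N ->
  forall k : nat, (1 <= k <= n - m)%N ->
    Lcut G k <= Lcut (sg_induced G h) k /\ Lcut (sg_induced G h) k <= Lcut G (k + m).
Proof.
move=> wfG h_inj /andP[m1 mn] k kn.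
have wfG' := sgraph_wf_induced h wfG.
have nn : (n - m <= n)%N := leq_subr m n.
have mn' : (m <= n)%N by rewrite (leq_trans mn)// leq_subr.
have kn' : (0 < k <= n)%N.
  by case/andP: kn => -> /leq_trans; apply.
have km : (0 < k + m <= n)%N.
  by case/andP: kn => k0 kn; rewrite addn_gt0 k0/= addnC -leq_subRL.
have cG' := is_cvg_Lcut wfG' kn.
split.
  (* The added 0 is the limit of [2^-p] times [cut_bound G]. *)
  rewrite -[leRHS]addr0 -[X in _ + X](mul0r (cut_bound G)).
  have cb : 2 `^ (- p) * lambda (sg_induced G h) p k +
      2 `^ (- p) * cut_bound G @[p --> +oo] -->
      Lcut (sg_induced G h) k + 0 * cut_bound G.
    by apply: cvgD; [exact: cG'|apply: cvgMr_tmp; exact: cvg_powR2N].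
  apply: ler_cvg_to (is_cvg_Lcut wfG kn') cb _.
  apply: filterS (nbhs_pinfty_gt (num_real (0 : R))) => p p0 /=.
  by rewrite -mulrDr ler_wpM2l ?powR_ge0// lambda_le_induced.
apply: ler_cvg_to cG' (is_cvg_Lcut wfG km) _.
apply: filterS (nbhs_pinfty_gt (num_real (0 : R))) => p p0 /=.
rewrite ler_wpM2l ?powR_ge0//.
by have := induced_le_lambda wfG h_inj p0 nn kn; rewrite subKn.
Qed.
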